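(* Let $\mathcal W$ be a discrete memoryless channel from a finite set $\mathcal X$ to a finite set $\mathcal Y$. Then for every integer $L\ge1$, $E_L^{\emptyset}(0^+,\mathcal W)\le U(\mathcal W)$, and moreover $\sup_{L\ge1}E_L^{\emptyset}(0^+,\mathcal W)=U(\mathcal W)$.
   Context: For probability distributions $P,Q$ on a finite set, $D(P\|Q)=\sum_x P(x)\log\frac{P(x)}{Q(x)}$ ($0\log(0/q)=0$; $+\infty$ if $P\not\ll Q$). A discrete memoryless channel $\mathcal W$ is a stochastic matrix $(\mathcal W(y|x))$; $\mathcal W^{\times n}(y^n|x^n)=\prod_i\mathcal W(y_i|x_i)$. The channel umlaut information is $U(\mathcal W)=\max_{P_X}\min_{Q_Y}D(P_X\times Q_Y\|P_{XY})$, $P_{XY}(x,y)=P_X(x)\mathcal W(y|x)$. An $L$-list unassisted code for message set $[M]$ (with $M\ge L$) and channel $\mathcal W$ consists of an encoder, i.e. a conditional distribution $\mathcal E(x|w)$, $w\in[M]$, and a decoder, i.e. a conditional distribution $\mathcal D(S|y)$ over subsets $S\subseteq[M]$ of cardinality $L$. With a uniformly distributed message $W$, the error probability is $\mathbb P[W\notin \hat S]$ where $\hat S$ is the decoder output; $\epsilon_L^{\emptyset}(M,\mathcal W)$ is the minimum error probability over such codes. Define $E_L^\emptyset(r,\mathcal W)=\liminf_{n\to\infty}-\frac1n\log\epsilon_L^\emptyset(\lceil L e^{rn}\rceil,\mathcal W^{\times n})$ and $E_L^\emptyset(0^+,\mathcal W)=\lim_{r\to0^+}E_L^\emptyset(r,\mathcal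 W)$. *)

(* Defs.v *)
From mathcomp Require Import all_boot all_order all_algebra.
From mathcomp Require Import all_classical all_reals all_analysis.
Set Implicit Arguments. Unset Strict Implicit. Unset Printing Implicit Defensive.
Import Order.TTheory GRing.Theory Num.Theory.
Import numFieldNormedType.Exports.
Local Open Scope classical_set_scope.
Local Open Scope ring_scope.

Section InfoDefs.
Variable R : realType.

Definition dist (T : finType) : set (T -> R) :=
  [set P | (forall t, 0 <= P t) /\ \sum_(t : T) P t = 1].

Definition stochastic (A B : finType) (V : A -> B -> R) : Prop :=
  (forall a b, 0 <= V a b) /\ (forall a, \sum_(b : B) V a b = 1).

Definition KL (T : finType) (P Q : T -> R) : \bar R :=
  if [exists t, (P t != 0) && (Q t == 0)] then +oo%E
  else (\sum_(t : T) (if P t == 0 then 0 else P t * ln (P t / Q t)))%:E.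

Definition prod_dist (X Y : finType) (P : X -> R) (Q : Y -> R) : X * Y -> R :=
  fun xy => P xy.1 * Q xy.2.
Definition joint_dist (X Y : finType) (P : X -> R) (V : X -> Y -> R) : X * Y -> R :=
  fun xy => P xy.1 * V xy.1 xy.2.

Definition umlaut (X Y : finType) (V : X -> Y -> R) : \bar R :=
  ereal_sup [set ereal_inf [set KL (prod_dist P Q) (joint_dist P V) | Q in @dist Y]
            | P in @dist X].

Definition chan_pow (X Y : finType) (V : X -> Y -> R) (n : nat)
  : {ffun 'I_n -> X} -> {ffun 'I_n -> Y} -> R :=
  fun xn yn => \prod_(i < n) V (xn i) (yn i).

Definition is_encoder (A : finType) (M : nat) (E : 'I_M -> A -> R) : Prop :=
  (forall w a, 0 <= E w a) /\ (forall w, \sum_(a : A) E w a = 1).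

Definition is_list_decoder (B : finType) (L M : nat) (D : B -> {set 'I_M} -> R)
  : Prop :=
  [/\ (forall b (S : {set 'I_M}), 0 <= D b S),
      (forall b, \sum_(S : {set 'I_M}) D b S = 1)
    & (forall b (S : {set 'I_M}), #|S| != L -> D b S = 0)].

Definition list_err (A B : finType) (V : A -> B -> R) (M : nat)
  (E : 'I_M -> A -> R) (D : B -> {set 'I_M} -> R) : R :=
  M%:R^-1 * \sum_(w < M) \sum_(a : A) \sum_(b : B)
     \sum_(S : {set 'I_M} | w \notin S) E w a * V a b * D b S.

Definition eps_list (A B : finType) (V : A -> B -> R) (L M : nat) : R :=
  inf [set p | exists (E : 'I_M -> A -> R) (D : B -> {set 'I_M} -> R),
                 [/\ is_encoder E, is_list_decoder L D & p = list_err V E D]].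

Definition neglog (p : R) : \bar R :=
  if p == 0 then +oo%E else (- ln p)%:E.

Definition list_exponent (X Y : finType) (V : X -> Y -> R) (L : nat) (r : R)
  : \bar R :=
  limn_einf (fun n : nat =>
    ((n%:R)^-1)%:E *
    neglog (eps_list (chan_pow (n:=n) V) L
              (`|Num.ceil (L%:R * expR (r * n%:R))|%N)))%E.

Definition list_exponent0 (X Y : finType) (V : X -> Y -> R) (L : nat) : \bar R :=
  lim (list_exponent V L r @[r --> 0^'+]).

End InfoDefs.

(* Main.v *)
Require Import Defs.
From mathcomp Require Import all_boot all_order all_algebra.
From mathcomp Require Import all_classical all_reals all_analysis.
From mathcomp Require Import ring lra.
Set Implicit Arguments. Unset Strict Implicit. Unset Printing Implicit Defensive.
Import Order.TTheory GRing.Theory Num.Theory.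
Import numFieldNormedType.Exports.
Local Open Scope ring_scope.

(* Converse: replacing the channel output by an independent output of law Q, an L-list
   code for M messages errs with probability 1 - L/M, so comparing the two situations
   bounds -ln(error) by about (D(P x Q || P_XY) + 1) / (1 - L/M). Taking for Q a product of
   near-optimal single-letter laws gives n U, and L/M tends to 0 at every positive rate.

   Achievability: for i.i.d. random codewords and the decoder listing the L most likely
   messages, the union bound over (L+1)-subsets of messages gives error at most
   M^L (sum_y (sum_x P(x) W(y|x)^(1/(L+1)))^(L+1))^n. As the rate goes to 0 the factor M^L
   is harmless, and as L grows the sum over y tends to
   sum_y prod_x W(y|x)^P(x) = exp(- min_Q D(P x Q || P_XY)).

   The limit r -> 0+ exists because the exponent is nonincreasing in r. *)

(** * One-shot converse *)

(* Tangent line of the exponential at the tilt [t], applied to the likelihood ratio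
   [v / q]: summed over messages, inputs and outputs, and with [t] tuned at the end,
   it replaces the data-processing inequality of the meta-converse. *)
Lemma tilted_error_bound (R : realType) (m q v g t : R) :
    0 <= m -> 0 <= q -> 0 <= v -> 0 <= g <= 1 ->
    (m != 0 -> q != 0 -> v != 0) ->
  expR t * (m * q * g * (1 - t) - m * q * ln (q / v) - m * v) <= m * v * g.
Proof.
move=> m0 q0 v0 /andP[g0 g1] mqv; have et := expR_gt0 t.
have [->|mN0] := eqVneq m 0; first by rewrite !mul0r !subr0 mulr0.
have [->|qN0] := eqVneq q 0.
  rewrite mulr0 !mul0r subr0 sub0r mulrN (@le_trans _ _ 0)//.
    by rewrite oppr_le0 mulr_ge0 ?mulr_ge0// ltW.
  by rewrite !mulr_ge0.
have vN0 := mqv mN0 qN0.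
have qp : 0 < q by rewrite lt_def qN0.
have vp : 0 < v by rewrite lt_def vN0.
set l := ln (q / v).
have vE : v = q * expR (- l).
  by rewrite expRN lnK ?posrE ?divr_gt0// invf_div mulrC divfK.
have h1 : q * g * (1 - l - t) * expR t <= v * g.
  have -> : v * g = q * g * expR (- l - t) * expR t.
    by rewrite -[_ * _ * expR t]mulrA -expRD subrK {1}vE; ring.
  rewrite ler_wpM2r ?expR_ge0// ler_wpM2l ?mulr_ge0//.
  by rewrite (le_trans _ (expR_ge1Dx _))//; lra.
(* [h1] weights the log-likelihood by [g], while the goal carries it unweighted. The gap
   [(1 - g) * (- (q * l))] is at most [v], which is where the term [- m * v] comes from. *)
have h2 : q * (1 - l) <= v by rewrite vE ler_wpM2l// expR_ge1Dx.
have h3 : (1 - g) * (- (q * l)) <= v.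
  apply: (@le_trans _ _ ((1 - g) * v)); last by nra.
  by rewrite ler_wpM2l ?subr_ge0//; nra.
have -> : m * v * g = m * (v * g) by ring.
have -> : expR t * (m * q * g * (1 - t) - m * q * l - m * v) =
  m * ((q * g * (1 - t) - q * l - v) * expR t) by ring.
rewrite ler_wpM2l// (le_trans _ h1)// ler_wpM2r ?expR_ge0//; nra.
Qed.

Section OneShotConverse.
Variables (R : realType) (A B : finType) (V : A -> B -> R) (L M : nat).
Variables (E : 'I_M -> A -> R) (D : B -> {set 'I_M} -> R).
Hypotheses (HV : stochastic V) (HE : is_encoder E) (HD : is_list_decoder L D).

Definition miss (w : 'I_M) (b : B) : R := \sum_(S : {set _} | w \notin S) D b S.

Lemma miss_itv w b : 0 <= miss w b <= 1.
Proof.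
have [D0 D1 _] := HD; rewrite sumr_ge0//= -(D1 b) [leRHS](bigID (fun S : {set 'I_M} => w \notin S))/=.
by rewrite lerDl sumr_ge0.
Qed.

(** Every list in the support of [D b] omits exactly [M - L] messages. Hence an output independent
    of the message forces error [1 - L / M]. *)
Lemma sum_miss b : \sum_w miss w b = M%:R - L%:R.
Proof.
have [D0 D1 DL] := HD.
rewrite /miss (exchange_big_dep xpredT)//=.
rewrite (eq_bigr (fun S : {set 'I_M} => (M%:R - L%:R) * D b S)) => [|S _].
  by rewrite -mulr_sumr D1 mulr1.
rewrite sumr_const; have [SL|SL] := eqVneq #|S| L; last first.
  by rewrite DL// mulr0 mul0rn.
have /(congr1 (fun k => k%:R : R)) := cardC (mem S).
rewrite card_ord natrD -SL => <-; rewrite addrC addKr mulr_natl.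
by congr (_ *+ _); apply: eq_card => i; rewrite !inE.
Qed.

Lemma list_errE :
  list_err V E D = \sum_w \sum_a \sum_b M%:R^-1 * E w a * V a b * miss w b.
Proof.
rewrite /list_err mulr_sumr; apply: eq_bigr => w _.
rewrite mulr_sumr; apply: eq_bigr => a _; rewrite mulr_sumr.
by apply: eq_bigr => b _; rewrite /miss !mulr_sumr; apply: eq_bigr => S _; ring.
Qed.

Lemma list_err_ge (Q : B -> R) (d : R) : dist Q -> (L < M)%N ->
    (forall w a b, E w a != 0 -> Q b != 0 -> V a b != 0) ->
    \sum_w \sum_a \sum_b M%:R^-1 * E w a * Q b * ln (Q b / V a b) <= d ->
  (1 - L%:R / M%:R) * expR (- ((d + 1) / (1 - L%:R / M%:R))) <= list_err V E D.
Proof.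
move=> [Q0 Q1] LM ac Dd; have [E0 E1] := HE; have [V0 V1] := HV.
(* [al] is the error probability under the independent output. The tilt [t] is chosen so that
   [al * (1 - t) - d - 1 = al], which turns the summed tangent bound into [al * expR t]. *)
set al := 1 - _; set t := - _.
have M0 : (0 < M%:R :> R) by rewrite ltr0n (leq_ltn_trans _ LM).
have al0 : 0 < al by rewrite subr_gt0 ltr_pdivrMr// mul1r ltr_nat.
pose m w a := M%:R^-1 * E w a.
have m0 w a : 0 <= m w a by rewrite mulr_ge0// invr_ge0 ltW.
have sm (F : 'I_M -> A -> B -> R) (G : 'I_M -> R) :
  (forall w a, \sum_b F w a b = m w a * G w) ->
  \sum_w \sum_a \sum_b F w a b = M%:R^-1 * \sum_w G w.
  move=> FG; rewrite mulr_sumr; apply: eq_bigr => w _.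
  under eq_bigr do rewrite FG; rewrite -mulr_suml -mulr_sumr E1 mulr1 //.
have sv : \sum_w \sum_a \sum_b m w a * V a b = 1.
  rewrite (sm _ (fun=> 1)) ?sumr_const ?card_ord ?mulVf ?gt_eqF//.
  by move=> w a; rewrite -mulr_sumr V1.
have sg : \sum_w \sum_a \sum_b m w a * Q b * miss w b = al.
  rewrite (sm _ (fun w => \sum_b Q b * miss w b)); last first.
    by move=> w a; rewrite mulr_sumr; apply: eq_bigr => b _; rewrite mulrA.
  rewrite exchange_big/=; under eq_bigr do rewrite -mulr_sumr sum_miss.
  by rewrite -mulr_suml Q1 mul1r mulrBr mulVf ?gt_eqF// mulrC.
rewrite list_errE.
apply: (@le_trans _ _ (\sum_w \sum_a \sum_b expR t * (m w a * Q b * miss w b * (1 - t)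
   - m w a * Q b * ln (Q b / V a b) - m w a * V a b))); last first.
  apply: ler_sum => w _; apply: ler_sum => a _; apply: ler_sum => b _.
  apply: tilted_error_bound => //; first exact: miss_itv.
  rewrite mulf_eq0 negb_or => /andP[_ Ewa]; exact: ac Ewa.
have -> : \sum_w \sum_a \sum_b expR t * (m w a * Q b * miss w b * (1 - t)
   - m w a * Q b * ln (Q b / V a b) - m w a * V a b) = expR t * (al * (1 - t)
   - \sum_w \sum_a \sum_b M%:R^-1 * E w a * Q b * ln (Q b / V a b) - 1).
  rewrite -[in RHS]sg -[X in _ = _ * (_ - _ - X)]sv.
  do 3 (rewrite ?(mulr_suml, mulr_sumr) -!sumrB ?mulr_sumr; apply: eq_bigr => ? _).
  by [].
have alt : al * t = - (d + 1) by rewrite /t mulrN mulrC divfK ?gt_eqF.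
rewrite mulrC ler_wpM2l ?expR_ge0//; lra.
Qed.

End OneShotConverse.

(** * Product channels *)

Section Tensorization.
Variable R : realType.

Lemma ln_prod (I : finType) (F : I -> R) :
  (forall i, 0 < F i) -> ln (\prod_i F i) = \sum_i ln (F i).
Proof.
move=> F0; rewrite -[RHS]expRK expR_sum; congr ln.
by apply: eq_bigr => i _; rewrite lnK ?posrE.
Qed.

Lemma chan_pow_stochastic (X Y : finType) (W : X -> Y -> R) n :
  stochastic W -> stochastic (chan_pow (n:=n) W).
Proof.
move=> [W0 W1]; split=> [xn yn|xn]; first exact: prodr_ge0.
by rewrite -(bigA_distr_bigA (fun i y => W (xn i) y)) big1.
Qed.

Lemma dist_prod (Y : finType) n (Q : 'I_n -> Y -> R) :
  (forall i, dist (Q i)) -> dist (fun yn : {ffun 'I_n -> Y} => \prod_i Q i (yn i)).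
Proof.
move=> HQ; split=> [yn|]; first by apply: prodr_ge0 => i _; case: (HQ i).
by rewrite -bigA_distr_bigA big1// => i _; case: (HQ i).
Qed.

Lemma sum_prod_single (Y : finType) n (Q : 'I_n -> Y -> R) (i : 'I_n) (l : Y -> R) :
    (forall i, dist (Q i)) ->
  \sum_(yn : {ffun 'I_n -> Y}) (\prod_j Q j (yn j)) * l (yn i) = \sum_y Q i y * l y.
Proof.
move=> HQ; pose F j y := Q j y * (if j == i then l y else 1).
rewrite (eq_bigr (fun yn : {ffun 'I_n -> Y} => \prod_j F j (yn j))); last first.
  move=> yn _; rewrite big_split/=; congr (_ * _).
  by rewrite (bigD1 i)//= eqxx big1 ?mulr1// => j /negPf ->.
rewrite -(bigA_distr_bigA F) (bigD1 i)//= [X in _ * X]big1 => [|j /negPf ji].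
  by rewrite mulr1; apply: eq_bigr => y _; rewrite /F eqxx.
rewrite /F ji; under eq_bigr do rewrite mulr1.
by case: (HQ j).
Qed.

(** A finite divergence excludes the infinite branch of [KL], hence absolute continuity. [P] cancels
    inside the logarithm, so for fixed [Q] the divergence is linear in [P]; single-letterization
    rests on this linearity. *)
Lemma KL_prod_joint_lt (X Y : finType) (P : X -> R) (Q : Y -> R) (W : X -> Y -> R)
    (u : R) : (KL (prod_dist P Q) (joint_dist P W) < u%:E)%E ->
  (forall x y, P x != 0 -> Q y != 0 -> W x y != 0) /\
  \sum_x P x * (\sum_y Q y * ln (Q y / W x y)) < u.
Proof.
rewrite /KL; case: ifPn => [//|/existsPn fin]; rewrite lte_fin => KLu; split.
  move=> x y Px Qy; have := fin (x, y).
  by rewrite /prod_dist /joint_dist/= !mulf_eq0 (negPf Px) (negPf Qy)/=.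
apply: le_lt_trans KLu; rewrite le_eqVlt; apply/orP; left; apply/eqP.
under eq_bigr do rewrite mulr_sumr.
rewrite pair_big/=; apply: eq_bigr => -[x y] _; rewrite /prod_dist /joint_dist/=.
have [->|Px] := eqVneq (P x) 0; first by rewrite !mul0r eqxx.
have [->|Qy] := eqVneq (Q y) 0; first by rewrite !(mul0r, mulr0) eqxx.
by rewrite mulf_eq0 (negPf Px) (negPf Qy)/= mulrA -mulf_div divff// mul1r.
Qed.

(* The product of the optimal output distributions of the single-letter marginals
   single-letterizes the divergence, whatever the joint input distribution is. *)
Lemma tensorized_output (X Y : finType) (W : X -> Y -> R) (u : R) n M
    (E : 'I_M -> {ffun 'I_n -> X} -> R) :
    stochastic W -> (0 < M)%N -> is_encoder E ->
    (forall P : X -> R, dist P -> exists2 Q : Y -> R, dist Q &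
       (KL (prod_dist P Q) (joint_dist P W) < u%:E)%E) ->
  exists Q : {ffun 'I_n -> Y} -> R, [/\ dist Q,
    (forall w a b, E w a != 0 -> Q b != 0 -> chan_pow W a b != 0) &
    \sum_w \sum_a \sum_b M%:R^-1 * E w a * Q b * ln (Q b / chan_pow W a b) <= n%:R * u].
Proof.
move=> HW M0 [E0 E1] HQ.
have Mi : 0 < (M%:R^-1 : R) by rewrite invr_gt0 ltr0n.
pose m w a := M%:R^-1 * E w a.
have m0 w a : 0 <= m w a by rewrite mulr_ge0// ltW.
(* [P i] is the law of the [i]-th input letter when the message is uniform. *)
pose P i x := \sum_w \sum_(a : {ffun 'I_n -> X} | a i == x) m w a.
have PE i (h : X -> R) :
    \sum_x P i x * h x = \sum_w \sum_(a : {ffun 'I_n -> X}) m w a * h (a i).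
  under eq_bigr do rewrite mulr_suml; rewrite exchange_big/=.
  apply: eq_bigr => w _; rewrite [RHS](partition_big (fun a : {ffun 'I_n -> X} => a i) xpredT)//=.
  by apply: eq_bigr => x _; rewrite mulr_suml; apply: eq_bigr => a /eqP ->.
have Pdist i : dist (P i).
  split=> [x|]; first by do 2 apply: sumr_ge0 => ? _.
  transitivity (\sum_x P i x * 1); first by apply: eq_bigr => ? _; rewrite mulr1.
  rewrite (PE i (fun=> 1)).
  under eq_bigr do (under eq_bigr do rewrite mulr1; rewrite -mulr_sumr E1 mulr1).
  by rewrite sumr_const card_ord -[LHS]mulr_natl divff// pnatr_eq0 -lt0n.
have /choice[Q HQi] : forall i, exists Q : Y -> R, dist Q /\
    (KL (prod_dist (P i) Q) (joint_dist (P i) W) < u%:E)%E.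
  by move=> i; have [Q] := HQ _ (Pdist i); exists Q.
have dQ i : dist (Q i) by have [] := HQi i.
(* A word used by the encoder has all its letters in the supports of the marginals, so absolute
   continuity lifts from letters to words. *)
have Pneq0 w a i : E w a != 0 -> P i (a i) != 0.
  move=> Ewa; rewrite gt_eqF// /P (bigD1 w)//= (bigD1 a)//=.
  have mwa : 0 < m w a by rewrite mulr_gt0// lt_def Ewa E0.
  rewrite -addrA ltr_wpDr//; apply: addr_ge0; first exact: sumr_ge0.
  by do 2 apply: sumr_ge0 => ? _.
pose Qn (b : {ffun 'I_n -> Y}) := \prod_i Q i (b i).
have Qn0 b i : Qn b != 0 -> Q i (b i) != 0.
  by rewrite /Qn => /prodf_neq0/(_ i isT).
have ac i x y : P i x != 0 -> Q i y != 0 -> W x y != 0.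
  by have [_ /KL_prod_joint_lt[aci _]] := HQi i; exact: aci.
exists Qn; split; first exact: dist_prod.
  move=> w a b Ewa Qb; apply/prodf_neq0 => i _.
  by apply: (ac i); [exact: Pneq0 Ewa|exact: Qn0].
have -> : \sum_w \sum_a \sum_b M%:R^-1 * E w a * Qn b * ln (Qn b / chan_pow W a b) =
    \sum_(i < n) \sum_x P i x * \sum_y Q i y * ln (Q i y / W x y).
  under [RHS]eq_bigr do rewrite PE.
  rewrite [RHS]exchange_big/=; apply: eq_bigr => w _.
  rewrite [RHS]exchange_big/=; apply: eq_bigr => a _.
  under [RHS]eq_bigr => i do rewrite -(sum_prod_single i (fun y => ln (Q i y / W (a i) y)) dQ) mulr_sumr.
  rewrite [RHS]exchange_big/=; apply: eq_bigr => b _.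
  rewrite -/(Qn b) -mulr_sumr -mulr_sumr /m -!mulrA.
  have [->|Ewa] := eqVneq (E w a) 0; first by rewrite !(mul0r, mulr0).
  have [->|Qb] := eqVneq (Qn b) 0; first by rewrite !(mul0r, mulr0).
  congr (_ * (_ * (_ * _))).
  rewrite /chan_pow /Qn -prodf_div.
  apply: ln_prod => i; rewrite divr_gt0// lt_def ?Qn0//= ?(HW.1) ?(dQ i).1//.
  by rewrite andbT; apply: (ac i); [exact: Pneq0 Ewa|exact: Qn0].
have : \sum_(i < n) \sum_x P i x * \sum_y Q i y * ln (Q i y / W x y) <= \sum_(i < n) u.
  by apply: ler_sum => i _; have [_ /KL_prod_joint_lt[_ /ltW]] := HQi i.
by rewrite sumr_const card_ord mulr_natl.
Qed.

End Tensorization.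

(** * Random list codes *)

Section RandomCoding.
Variable R : realType.

(** If [F] exceeded its mean everywhere, the nonnegative terms [mu s * (F s - m)] would sum to 0,
    forcing [mu] to vanish. This extracts one good codebook from the random ensemble. *)
Lemma exists_le_mean (T : finType) (mu F : T -> R) :
  dist mu -> exists t, F t <= \sum_s mu s * F s.
Proof.
move=> [mu0 mu1]; apply: contrapT => /forallNP Flt; set m := \sum_s _ in Flt.
suff : \sum_s mu s * (F s - m) = 0.
  move=> /eqP; rewrite psumr_eq0 => [/allP s0|s _]; last first.
    by rewrite mulr_ge0// subr_ge0 ltW// ltNge; apply/negP/Flt.
  have : \sum_s mu s = 0.
    apply: big1 => s _; have := s0 s (mem_index_enum _).
    rewrite mulf_eq0 subr_eq0 => /orP[/eqP//|/eqP Fs].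
    by case: (Flt s); rewrite Fs.
  by rewrite mu1 => /eqP; rewrite oner_eq0.
under eq_bigr do rewrite mulrBr.
by rewrite sumrB -mulr_suml mu1 mul1r subrr.
Qed.

Lemma sum_pred1 (T : finType) (s : T) : \sum_t (t == s)%:R = 1 :> R.
Proof. by rewrite (bigD1 s)//= eqxx big1 ?addr0// => t /negPf ->. Qed.

(** Greedy choice: a maximizer of [f] outside the current set is added at each step. With [f] a
    likelihood this is the maximum-likelihood list; a constant or an indicator [f] serves for purely
    combinatorial choices. *)
Lemma exists_top_set M L (f : 'I_M -> R) : (L <= M)%N ->
  exists2 S : {set 'I_M}, #|S| = L &
    forall w w', w \notin S -> w' \in S -> f w <= f w'.
Proof.
elim: L => [_|L IH LM].
  by exists finset.set0; rewrite ?cards0// => w w'; rewrite !inE.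
have [S SL top] := IH (ltnW LM).
have [w0 w0S] : exists w0, w0 \notin S.
  apply/existsP; rewrite -[[exists _, _]]negbK; apply/negP => /existsPn allS.
  suff : S = finset.setT by move=> ST; move: LM; rewrite -SL ST cardsT card_ord ltnn.
  by apply/finset.setP => w; rewrite inE; have := allS w; rewrite negbK.
case: (@arg_maxP _ _ _ w0 (fun w => w \notin S) f w0S) => m mS mmax.
exists (m |: S); first by rewrite cardsU1 mS SL.
move=> w w'; rewrite !inE negb_or => /andP[wm wS] /orP[/eqP->|w'S]; first exact: mmax.
exact: top.
Qed.

Lemma leq_bin_expn M L : ('C(M, L) <= M ^ L)%N.
Proof.
elim: L M => [M|L IH [|M]]; rewrite ?bin0// ?bin0n//.
apply: (@leq_trans (L.+1 * 'C(M.+1, L.+1))); first by rewrite leq_pmull.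
rewrite -mul_bin_diag expnS leq_mul2l/= (leq_trans (IH _))//.
by case: L {IH} => [|L]; rewrite ?expn0 ?leq_exp2r.
Qed.

Lemma list_err_ge0 (A B : finType) (V : A -> B -> R) L M (E : 'I_M -> A -> R)
    (D : B -> {set 'I_M} -> R) :
  stochastic V -> is_encoder E -> is_list_decoder L D -> 0 <= list_err V E D.
Proof.
move=> [V0 _] [E0 _] [D0 _ _]; rewrite /list_err mulr_ge0 ?invr_ge0//.
by do 4 (apply: sumr_ge0 => ? _); rewrite !mulr_ge0.
Qed.

Lemma eps_list_le (A B : finType) (V : A -> B -> R) L M (E : 'I_M -> A -> R)
    (D : B -> {set 'I_M} -> R) :
    stochastic V -> is_encoder E -> is_list_decoder L D ->
  eps_list V L M <= list_err V E D.
Proof.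
move=> HV HE HD; apply: ge_inf; last by exists E, D.
by exists 0 => _ [E' [D' [HE' HD' ->]]]; exact: list_err_ge0 HD'.
Qed.

Section Codebook.
Variables (A B : finType) (V : A -> B -> R) (L M : nat).
Variables (c : 'I_M -> A) (s : B -> {set 'I_M}).

Definition codebook_encoder (w : 'I_M) (a : A) : R := (a == c w)%:R.
Definition set_decoder (b : B) (S : {set 'I_M}) : R := (S == s b)%:R.

Lemma codebook_encoderP : is_encoder codebook_encoder.
Proof.
split=> [w a|w]; first exact: ler0n.
exact: sum_pred1.
Qed.

Lemma set_decoderP : (forall b, #|s b| = L) -> is_list_decoder L set_decoder.
Proof.
move=> sL; split=> [b S|b|b S SL]; first exact: ler0n.
  exact: sum_pred1.
by rewrite /set_decoder; case: eqP => // Ss; rewrite Ss sL eqxx in SL.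
Qed.

Lemma list_err_codebook : list_err V codebook_encoder set_decoder =
  M%:R^-1 * \sum_b \sum_(w | w \notin s b) V (c w) b.
Proof.
rewrite /list_err; congr (_ * _); rewrite [RHS](exchange_big_dep xpredT)//=.
apply: eq_bigr => w _.
rewrite (bigD1 (c w))//= [X in _ + X]big1 => [|a /negPf ac]; last first.
  by do 2 apply: big1 => ? _; rewrite /codebook_encoder ac !mul0r.
rewrite addr0 [RHS]big_mkcond/=; apply: eq_bigr => b _.
rewrite /codebook_encoder eqxx big_mkcond/= (bigD1 (s b))//= big1 ?addr0.
  by rewrite /set_decoder eqxx mul1r mulr1.
by move=> S /negPf Ss; rewrite /set_decoder Ss mulr0 if_same.
Qed.

End Codebook.

(* If [w] is not on the list then its likelihood is at most those of the [L] messages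
   on the list, hence at most the geometric mean over these [L + 1] messages. *)
Lemma random_list_code (A B : finType) (V f : A -> B -> R) (P : A -> R) L M :
    dist P -> (forall a b, 0 <= f a b) -> (forall a b, f a b ^+ L.+1 = V a b) ->
    (0 < M)%N -> (L <= M)%N ->
  exists (E : 'I_M -> A -> R) (D : B -> {set 'I_M} -> R),
    [/\ is_encoder E, is_list_decoder L D &
      list_err V E D <= M%:R ^+ L * \sum_b (\sum_a P a * f a b) ^+ L.+1].
Proof.
move=> [P0 P1] f0 fV M0 LM.
pose mu (c : {ffun 'I_M -> A}) := \prod_w P (c w).
have dmu : dist mu by exact: (@dist_prod _ _ _ (fun=> P)).
(* The union bound: [Rc c] sums the geometric-mean likelihood over every conceivable list [T] that
   omits [w], so it no longer depends on the decoder. *)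
pose Rc (c : {ffun 'I_M -> A}) := M%:R^-1 * \sum_b \sum_w
  \sum_(T : {set 'I_M} | (w \notin T) && (#|T| == L)) \prod_(w' in w |: T) f (c w') b.
have [c Rcle] := exists_le_mean Rc dmu.
have /choice[s Hs] : forall b, exists S : {set 'I_M}, #|S| = L /\
    forall w w', w \notin S -> w' \in S -> f (c w) b <= f (c w') b.
  by move=> b; have [S] := exists_top_set (fun w => f (c w) b) LM; exists S.
exists (codebook_encoder c), (set_decoder s); split.
- exact: codebook_encoderP.
- by apply: set_decoderP => b; case: (Hs b).
have Mi : 0 <= M%:R^-1 :> R by rewrite invr_ge0.
have {}Rcle : list_err V (codebook_encoder c) (set_decoder s) <= \sum_c mu c * Rc c.
  apply: le_trans Rcle; rewrite list_err_codebook ler_wpM2l//.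
  apply: ler_sum => b _; rewrite big_mkcond/=; apply: ler_sum => w _.
  case: ifPn => [ws|_]; last by apply: sumr_ge0 => T _; exact: prodr_ge0.
  have [sL top] := Hs b.
  (* Only the term [T = s b] is kept; each of its [L] listed factors is at least [f (c w) b]. *)
  rewrite (bigD1 (s b)) ?ws ?sL ?eqxx//= ler_wpDr//.
    by apply: sumr_ge0 => T _; exact: prodr_ge0.
  rewrite big_setU1//= -fV exprS ler_wpM2l// -sL -prodr_const.
  by apply: ler_prod => w' w's; rewrite f0 top.
apply: (le_trans Rcle).
have -> : \sum_c mu c * Rc c = M%:R^-1 * \sum_b \sum_(w : 'I_M)
    \sum_(T : {set 'I_M} | (w \notin T) && (#|T| == L)) (\sum_a P a * f a b) ^+ L.+1.
  under eq_bigr do rewrite /Rc mulrCA mulr_sumr.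
  rewrite -mulr_sumr; congr (_ * _); rewrite exchange_big/=; apply: eq_bigr => b _.
  under eq_bigr do rewrite mulr_sumr.
  rewrite exchange_big/=; apply: eq_bigr => w _.
  under eq_bigr do rewrite mulr_sumr.
  rewrite exchange_big/=; apply: eq_bigr => T /andP[wT /eqP TL].
  (* Codewords are independent: each of the [L + 1] messages in [w |: T] contributes the average of
     [f], every other one contributes 1. *)
  pose F w' a := P a * (if w' \in w |: T then f a b else 1).
  rewrite (eq_bigr (fun c : {ffun 'I_M -> A} => \prod_w' F w' (c w'))); last first.
    by move=> c' _; rewrite big_split/= [X in _ * X]big_mkcond.
  rewrite -(bigA_distr_bigA F) (bigID (fun w' => w' \in w |: T))/=.
  rewrite [X in _ * X]big1 ?mulr1; last first.
    by move=> w' /negPf w'T; rewrite /F w'T; under eq_bigr do rewrite mulr1.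
  have <- : #|w |: T| = L.+1 by rewrite cardsU1 wT TL.
  rewrite -prodr_const; apply: eq_bigr => w' w'T.
  by rewrite /F w'T.
have F0 b : 0 <= (\sum_a P a * f a b) ^+ L.+1.
  by rewrite exprn_ge0// sumr_ge0// => a _; rewrite mulr_ge0.
rewrite [leRHS]mulr_sumr [leLHS]mulr_sumr; apply: ler_sum => b _.
apply: (@le_trans _ _ (M%:R^-1 * \sum_(w : 'I_M) M%:R ^+ L * (\sum_a P a * f a b) ^+ L.+1)).
  (* At most ['C(M, L)] lists avoid [w], and the sum over [w] cancels the prefactor [M%:R^-1]. *)
  rewrite ler_wpM2l//; apply: ler_sum => w _.
  rewrite sumr_const -[leLHS]mulr_natl ler_wpM2r// -natrX ler_nat.
  apply: leq_trans (leq_bin_expn M L); rewrite -[in leqRHS](card_ord M) -card_draws.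
  by apply: subset_leq_card; apply/fintype.subsetP => T; rewrite !inE => /andP[].
by rewrite sumr_const card_ord -[X in _ * X]mulr_natl mulKf// pnatr_eq0 -lt0n.
Qed.

(** With i.i.d. letters, both the codeword law and the root [f] factor over positions, so the sum
    over output words becomes an [n]-th power. *)
Lemma eps_list_random_le (X Y : finType) (W f : X -> Y -> R) (P : X -> R) L M n :
    stochastic W -> dist P -> (forall x y, 0 <= f x y) ->
    (forall x y, f x y ^+ L.+1 = W x y) -> (0 < M)%N -> (L <= M)%N ->
  eps_list (chan_pow (n:=n) W) L M <=
    M%:R ^+ L * (\sum_y (\sum_x P x * f x y) ^+ L.+1) ^+ n.
Proof.
move=> HW HP f0 fW M0 LM.
have [||E [D [HE HD err]]] := @random_list_code _ _ (chan_pow (n:=n) W)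
   (chan_pow (n:=n) f) _ L M (@dist_prod _ _ n _ (fun=> HP)) _ _ M0 LM.
- by move=> xn yn; exact: prodr_ge0.
- by move=> xn yn; rewrite /chan_pow -prodrXl; apply: eq_bigr.
apply: (le_trans (eps_list_le (chan_pow_stochastic n HW) HE HD)).
apply: (le_trans err); rewrite ler_wpM2l ?exprn_ge0//.
rewrite -[X in _ ^+ X](card_ord n) -prodr_const.
rewrite (bigA_distr_bigA (fun (i : 'I_n) y => (\sum_x P x * f x y) ^+ L.+1)).
rewrite le_eqVlt; apply/orP; left; apply/eqP; apply: eq_bigr => yn _.
rewrite prodrXl (bigA_distr_bigA (fun (i : 'I_n) x => P x * f x (yn i))).
by congr (_ ^+ _); apply: eq_bigr => xn _; rewrite -big_split.
Qed.

End RandomCoding.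

(** * Monotonicity of the error in the number of messages *)

Section Monotonicity.
Variables (R : realType) (A B : finType) (V : A -> B -> R) (L : nat).
Hypotheses (HV : stochastic V) (A0 : (0 < #|A|)%N).

Lemma eps_list_ge0 M : 0 <= eps_list V L M.
Proof.
rewrite /eps_list; set S := (X in inf X).
(* If there is no code at all, [inf] takes its default value 0. *)
have [->|/set0P ne] := eqVneq S set0; first by rewrite inf0.
by apply: lb_le_inf => // _ [E [D [HE HD ->]]]; exact: list_err_ge0 HD.
Qed.

(** A constant encoder with a constant list is a code, so the infimum is over a nonempty set and is
    not the default value. *)
Lemma eps_list_ge M (x : R) : (L <= M)%N ->
    (forall (E : 'I_M -> A -> R) D, is_encoder E -> is_list_decoder L D ->
       x <= list_err V E D) ->
  x <= eps_list V L M.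
Proof.
move=> LM xle; apply: lb_le_inf => [|_ [E [D [HE HD ->]]]]; last exact: xle.
have /card_gt0P[a _] := A0; have [S SL _] := exists_top_set (fun=> 0 : R) LM.
exists (list_err V (codebook_encoder R (fun=> a)) (set_decoder R (fun=> S))).
exists (codebook_encoder R (fun=> a)), (set_decoder R (fun=> S)).
by split=> //; [exact: codebook_encoderP|exact: set_decoderP].
Qed.

Lemma exists_superset M (T : {set 'I_M}) : (#|T| <= L <= M)%N ->
  exists2 S : {set 'I_M}, #|S| = L & T \subset S.
Proof.
move=> /andP[TL LM].
have [S SL top] := exists_top_set (fun w => (w \in T)%:R : R) LM.
exists S => //; apply/fintype.subsetP => w wT; apply: contraT => wS.
(* A missed [w] in [T] would force every element of [S] to have indicator 1, giving [T] more than
   [L] elements. *)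
have ST : w |: S \subset T.
  apply/fintype.subsetP => w'; rewrite !inE => /orP[/eqP->//|w'S].
  by have := top _ _ wS w'S; rewrite wT; case: (w' \in T) => //; rewrite ler10.
by have := leq_trans (subset_leq_card ST) TL; rewrite cardsU1 wS SL ltnn.
Qed.

(* Expurgating the worst message does not increase the average error. *)
Lemma eps_list_leS M : (0 < M)%N -> (L <= M)%N -> eps_list V L M <= eps_list V L M.+1.
Proof.
move=> M0 LM; apply: eps_list_ge; first exact: leqW.
move=> E D HE HD; have [E0 E1] := HE; have [D0 D1 DL] := HD; have [V0 _] := HV.
pose e w := \sum_a \sum_b E w a * V a b * miss D w b.
case: (@arg_maxP _ _ _ (ord0 : 'I_M.+1) xpredT e isT) => w0 _ w0max.
(* Deleting the worst message [w0] may shorten a list; [phi] pads it back to size [L], which can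
   only reduce the misses. *)
have /choice[phi Hphi] : forall S : {set 'I_M.+1}, exists S' : {set 'I_M},
    #|S| = L -> #|S'| = L /\ forall w, lift w0 w \in S -> w \in S'.
  move=> S; have [SL|SL] := eqVneq #|S| L; last by exists finset.set0 => /eqP; rewrite (negPf SL).
  have [|S' S'L sub] := @exists_superset M [set w | lift w0 w \in S].
    rewrite LM andbT -SL -(card_imset _ (@lift_inj _ w0)).
    apply: subset_leq_card; apply/fintype.subsetP => _ /imsetP[w + ->].
    by rewrite inE.
  exists S' => _; split=> // w wS; apply: (fintype.subsetP sub).
  by rewrite inE.
pose E' (w : 'I_M) := E (lift w0 w).
pose D' b (S' : {set 'I_M}) := \sum_(S : {set 'I_M.+1} | #|S| == L) D b S * (S' == phi S)%:R.
have HE' : is_encoder E' by split=> *; [exact: E0|exact: E1].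
have HD' : is_list_decoder L D'.
  split=> [b S'|b|b S' S'L].
  - by apply: sumr_ge0 => S _; rewrite mulr_ge0.
  - rewrite exchange_big/= -[RHS](D1 b) [RHS](bigID (fun S : {set 'I_M.+1} => #|S| == L))/=.
    rewrite [X in _ = _ + X]big1 ?addr0; last by move=> S /DL.
    apply: eq_bigr => S _; by rewrite -mulr_sumr sum_pred1 mulr1.
  - apply: big1 => S /eqP /Hphi[pL _]; case: eqP => [S'E|]; rewrite ?mulr0//.
    by rewrite S'E pL eqxx in S'L.
apply: (le_trans (eps_list_le HV HE' HD')).
have missle w b : miss D' w b <= miss D (lift w0 w) b.
  rewrite /miss exchange_big/= [leRHS]big_mkcond/= [leLHS]big_mkcond/=.
  apply: ler_sum => S _; case: ifPn => [/eqP SL|_]; last by case: ifP.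
  rewrite -mulr_sumr; case: ifPn => wS.
    rewrite -[leRHS]mulr1 ler_wpM2l// big_mkcond/= -[leRHS](sum_pred1 R (phi S)).
    by apply: ler_sum => S' _; case: ifP.
  rewrite big1 ?mulr0// => S' wS'; case: eqP => // S'E.
  by have [_ /(_ w)] := Hphi _ SL; rewrite -S'E (negPf wS'); rewrite negbK in wS; move=> /(_ wS).
rewrite !list_errE.
have eE M1 (E1' : 'I_M1 -> A -> R) D2 :
   \sum_w \sum_a \sum_b M1%:R^-1 * E1' w a * V a b * miss D2 w b =
   M1%:R^-1 * \sum_w \sum_a \sum_b E1' w a * V a b * miss D2 w b.
  by do 3 (rewrite mulr_sumr; apply: eq_bigr => ? _); rewrite !mulrA.
rewrite !eE -/e.
apply: (@le_trans _ _ (M%:R^-1 * \sum_w e (lift w0 w))).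
  rewrite ler_wpM2l ?invr_ge0//; apply: ler_sum => w _; apply: ler_sum => a _.
  apply: ler_sum => b _; apply: ler_wpM2l; last exact: missle.
  by rewrite mulr_ge0 ?E0 ?V0.
have -> : \sum_w \sum_a \sum_b E w a * V a b * miss D w b = e w0 + \sum_w e (lift w0 w).
  by rewrite (bigD1_ord w0).
have sle : \sum_w e (lift w0 w) <= M%:R * e w0.
  rewrite mulr_natl -[X in _ *+ X](card_ord M) -sumr_const.
  by apply: ler_sum => w _; exact: w0max.
rewrite ler_pdivrMl ?ltr0n// mulrCA ler_pdivlMl ?ltr0n// -natr1 mulrDl mul1r.
by rewrite mulrDr addrC lerD2r.
Qed.

Lemma eps_list_mono M M' : (0 < M)%N -> (L <= M)%N -> (M <= M')%N ->
  eps_list V L M <= eps_list V L M'.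
Proof.
move=> M0 LM /subnK <-; elim: (M' - M)%N => [//|k IH].
apply: (le_trans IH); apply: eps_list_leS.
  by rewrite (leq_trans M0)// leq_addl.
by rewrite (leq_trans LM)// leq_addl.
Qed.

End Monotonicity.

(** * Exponents at positive rate *)

Local Open Scope classical_set_scope.

Section Limits.
Variable R : realType.

(** Reduces the converse to real thresholds [u] strictly above [umlaut W], for which near-optimal
    output laws exist; the case [x = +oo] is immediate. *)
Lemma lee_of_lt_fin (x y : \bar R) :
  (forall u : R, (x < u%:E)%E -> (y <= u%:E)%E) -> (y <= x)%E.
Proof.
case: x => [r|_|H]; last 2 first.
- exact: leey.
- by case: y H => [s /(_ (s - 1)%R (ltNyr _))|/(_ 0%R (ltNyr _))|]//; rewrite lee_fin lerBrDr gerDl ler10.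
move=> H; apply/lee_addgt0Pr => e e0; rewrite -EFinD; apply: H.
by rewrite lte_fin ltrDl.
Qed.

Lemma le_limn_einf_near (u v : nat -> \bar R) :
  (\forall n \near \oo, u n <= v n)%E -> (limn_einf u <= limn_einf v)%E.
Proof.
move=> [N _ uv]; rewrite !limn_einf_lim; apply: lee_lim.
- exact: is_cvg_einfs.
- exact: is_cvg_einfs.
exists N => // n /= Nn; apply: le_ereal_inf_tmp => _ /= [m nm <-].
apply: le_trans (uv m _); last exact: leq_trans nm.
by apply: ereal_inf_lbound; exists m.
Qed.

Lemma limn_einf_EFin (u : nat -> R) (l : R) :
  u n @[n --> \oo] --> l -> limn_einf (fun n => (u n)%:E) = l%:E.
Proof.
move=> ul; apply: (cvg_limn_einf_sup _).1.
by apply: cvg_EFin => //; exact: nearW.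
Qed.

Lemma cvg_invn : (n%:R^-1 : R) @[n --> \oo] --> (0 : R).
Proof. by rewrite -cvg_shiftS; exact: cvg_harmonic. Qed.

Lemma absz_ceil_itv (x : R) : 0 <= x -> x <= (`|Num.ceil x|%N)%:R <= x + 1.
Proof.
move=> x0; have c0 : 0 <= Num.ceil x by rewrite ceil_ge0 (lt_le_trans _ x0)// ltrN10.
rewrite natr_absz ger0_norm// ceil_ge/=.
by have /andP[/ltW + _] := ceil_itv x; rewrite intrD mulrN1z; lra.
Qed.

Lemma neglog_le (p q : R) : 0 <= p -> p <= q -> (neglog q <= neglog p)%E.
Proof.
move=> p0 pq; rewrite /neglog.
have [_|pN0] := eqVneq p 0; first exact: leey.
have pp : 0 < p by rewrite lt_def pN0.
have qp := lt_le_trans pp pq.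
by rewrite (gt_eqF qp) lee_fin lerN2 ler_ln.
Qed.

Definition message_count (L : nat) (r : R) (n : nat) : nat :=
  `|Num.ceil (L%:R * expR (r * n%:R))|%N.

Lemma message_count_itv L r n :
  L%:R * expR (r * n%:R) <= (message_count L r n)%:R <= L%:R * expR (r * n%:R) + 1.
Proof. by apply: absz_ceil_itv; rewrite mulr_ge0 ?expR_ge0. Qed.

Lemma leq_message_count L r n : 0 <= r -> (L <= message_count L r n)%N.
Proof.
move=> r0; rewrite -(ler_nat R); have /andP[+ _] := message_count_itv L r n.
by apply: le_trans; rewrite ler_peMr// -[leLHS]expR0 ler_expR mulr_ge0.
Qed.

Lemma ltn_message_count L r n : (0 < L)%N -> 0 < r -> (0 < n)%N ->
  (L < message_count L r n)%N.
Proof.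
move=> L0 r0 n0; rewrite -(ltr_nat R); have /andP[+ _] := message_count_itv L r n.
by apply: lt_le_trans;  rewrite ltr_pMr ?ltr0n// expR_gt1 mulr_gt0 ?ltr0n.
Qed.

Lemma leq_message_count2 L r s n : r <= s ->
  (message_count L r n <= message_count L s n)%N.
Proof.
move=> rs; have c0 (t : R) : 0 <= Num.ceil (L%:R * expR (t * n%:R)).
  by rewrite ceil_ge0 (lt_le_trans (ltrN10 _))// mulr_ge0 ?expR_ge0.
rewrite /message_count -lez_nat !gez0_abs//; apply: le_ceil.
by rewrite ler_wpM2l// ler_expR ler_wpM2r.
Qed.

Section Exponent.
Variables (X Y : finType) (W : X -> Y -> R) (L : nat).
Hypotheses (HW : stochastic W) (HX : (0 < #|X|)%N) (L0 : (0 < L)%N).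

Let card_ffun_gt0 n : (0 < #|{ffun 'I_n -> X}|)%N.
Proof. by rewrite card_ffun expn_gt0 HX. Qed.

Lemma list_exponent_nonincreasing (r s : R) : 0 <= r -> r <= s ->
  (list_exponent W L s <= list_exponent W L r)%E.
Proof.
move=> r0 rs; apply: le_limn_einf_near; apply: nearW => n.
apply: lee_wpmul2l; first by rewrite lee_fin invr_ge0.
apply: neglog_le.
  by apply: eps_list_ge0; exact: chan_pow_stochastic.
have Lr := leq_message_count L n r0.
apply: eps_list_mono; [exact: chan_pow_stochastic|by []|exact: leq_trans Lr|exact: Lr|].
exact: leq_message_count2.
Qed.

Lemma list_exponent_cvg : list_exponent W L r @[r --> 0^'+] -->
  ereal_sup [set list_exponent W L r | r in `]0, +oo[].
Proof.
apply: (nonincreasing_at_right_cvge (+oo)%O) => [//|r s].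
rewrite !in_itv/= !andbT => r0 _ rs.
exact: list_exponent_nonincreasing (ltW r0) rs.
Qed.

Lemma list_exponent0E : list_exponent0 W L =
  ereal_sup [set list_exponent W L r | r in `]0, +oo[].
Proof. by apply/cvg_lim => //; exact: list_exponent_cvg. Qed.

Lemma list_exponent_le_umlaut (r : R) : 0 < r -> (list_exponent W L r <= umlaut W)%E.
Proof.
move=> r0; apply: lee_of_lt_fin => u Wu.
have HQ (P : X -> R) : dist P -> exists2 Q : Y -> R, dist Q &
    (KL (prod_dist P Q) (joint_dist P W) < u%:E)%E.
  move=> HP; have : (ereal_inf [set KL (prod_dist P Q) (joint_dist P W) | Q in @dist R Y]
    < u%:E)%E by apply: le_lt_trans Wu; apply: ereal_sup_ubound; exists P.
  by move=> /ereal_inf_lt[_ [Q HQ <-] ?]; exists Q.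
pose M n := message_count L r n.
pose al n : R := 1 - L%:R / (M n)%:R.
have al1 : al n @[n --> \oo] --> (1 : R).
  rewrite -[X in _ --> X]subr0; apply: cvgB; first exact: cvg_cst.
  (* [L / M n <= expR (- (r * n)) <= 1 / (r * n)], where positivity of the rate is essential. *)
  apply: (@squeeze_cvgr _ _ _ _ (fun=> 0) (fun n => r^-1 * n%:R^-1)).
  - near=> n; have n0 : (0 < n)%N by near: n; exact: nbhs_infty_gt.
    have M0 : (0 < (M n)%:R :> R).
      by rewrite ltr0n (leq_ltn_trans _ (ltn_message_count L0 r0 n0)).
    rewrite divr_ge0//= ler_pdivrMr// -invfM mulrC ler_pdivlMr ?mulr_gt0 ?ltr0n//.
    have /andP[+ _] := message_count_itv L r n; apply: le_trans.
    by rewrite ler_wpM2l// (le_trans _ (expR_ge1Dx _))// lerDr.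
  - exact: cvg_cst.
  - by rewrite -[X in _ --> X](mulr0 r^-1); apply: cvgM; [exact: cvg_cst|exact: cvg_invn].
(* [b n] is the normalized negative logarithm of the one-shot bound with [d = n * u]. *)
pose b n : R := n%:R^-1 * - ln (al n) + (u + n%:R^-1) / al n.
have bu : b n @[n --> \oo] --> u.
  have -> : u = 0 * - ln 1 + (u + 0) / 1 by rewrite mul0r add0r addr0 divr1.
  apply: cvgD.
    apply: cvgM; first exact: cvg_invn.
    apply: cvgN; apply: continuous_cvg al1; exact: continuous_ln.
  apply: cvgM; last by apply: cvgV => //; exact: oner_neq0.
  by apply: cvgD; [exact: cvg_cst|exact: cvg_invn].
rewrite -(limn_einf_EFin bu); apply: le_limn_einf_near.
near=> n; have n0 : (0 < n)%N by near: n; exact: nbhs_infty_gt.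
have LM := ltn_message_count L0 r0 n0; rewrite -/(M n) in LM.
have al0 : 0 < al n.
  by rewrite subr_gt0 ltr_pdivrMr ?mul1r ?ltr_nat// ltr0n (leq_ltn_trans _ LM).
pose p := al n * expR (- ((n%:R * u + 1) / al n)).
have p0 : 0 < p by rewrite mulr_gt0// expR_gt0.
have pe : p <= eps_list (chan_pow (n:=n) W) L (M n).
  apply: eps_list_ge; [exact: card_ffun_gt0|exact: ltnW|] => E D HE HD.
  have [Q [HQn ac Qu]] := tensorized_output HW (leq_ltn_trans (leq0n _) LM) HE HQ.
  by have := list_err_ge (chan_pow_stochastic n HW) HE HD HQn LM ac Qu.
apply: (@le_trans _ _ ((n%:R^-1)%:E * neglog p)%E).
  apply: lee_wpmul2l; first by rewrite lee_fin invr_ge0.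
  exact: neglog_le (ltW p0) pe.
rewrite /neglog gt_eqF// -EFinM lee_fin le_eqVlt; apply/orP; left; apply/eqP.
rewrite /p lnM ?posrE ?expR_gt0// expRK /b.
have : n%:R != 0 :> R by rewrite pnatr_eq0 -lt0n.
by move: al0; rewrite lt_def => /andP[? _] ?; field; apply/andP.
Unshelve. all: by end_near. Qed.

(** The factor [M ^ L] of the union bound costs [L * r] in the exponent. A positive upper bound [k]
    replaces the sum itself, which may be 0 and then has no usable logarithm. *)
Lemma list_exponent_ge (f : X -> Y -> R) (P : X -> R) (k r : R) :
    dist P -> (forall x y, 0 <= f x y) -> (forall x y, f x y ^+ L.+1 = W x y) ->
    0 < k -> \sum_y (\sum_x P x * f x y) ^+ L.+1 <= k -> 0 <= r ->
  ((- ln k - L%:R * r)%:E <= list_exponent W L r)%E.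
Proof.
move=> HP f0 fW k0 Kk r0.
(* The constant [L.+1] absorbs the ceiling: [M <= L * expR (r * n) + 1 <= L.+1 * expR (r * n)]. *)
pose b n : R := n%:R^-1 * - (L%:R * ln L.+1%:R) + (- ln k - L%:R * r).
have bl : b n @[n --> \oo] --> - ln k - L%:R * r.
  rewrite -[X in _ --> X]add0r -[X in _ --> X + _](mul0r (- (L%:R * ln L.+1%:R))).
  by apply: cvgD; [apply: cvgM; [exact: cvg_invn|exact: cvg_cst]|exact: cvg_cst].
rewrite -(limn_einf_EFin bl); apply: le_limn_einf_near.
near=> n; have n0 : (0 < n)%N by near: n; exact: nbhs_infty_gt.
pose q := (L.+1%:R * expR (r * n%:R)) ^+ L * k ^+ n.
have q0 : 0 < q by rewrite mulr_gt0 ?exprn_gt0 ?mulr_gt0 ?expR_gt0 ?ltr0n.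
have LM := leq_message_count L n r0.
have eq : eps_list (chan_pow (n:=n) W) L (message_count L r n) <= q.
  apply: (le_trans (eps_list_random_le n HW HP f0 fW (leq_trans L0 LM) LM)).
  have K0 : 0 <= \sum_y (\sum_x P x * f x y) ^+ L.+1.
    apply: sumr_ge0 => y _; rewrite exprn_ge0// sumr_ge0// => x _.
    by rewrite mulr_ge0//; case: HP.
  apply: ler_pM; rewrite ?exprn_ge0//; last by rewrite lerXn2r// nnegrE// ltW.
  rewrite lerXn2r ?nnegrE ?mulr_ge0 ?expR_ge0//.
  have /andP[_ /le_trans] := message_count_itv L r n; apply.
  by rewrite -natr1 mulrDl mul1r lerD2l -[leLHS]expR0 ler_expR mulr_ge0.
apply: (@le_trans _ _ ((n%:R^-1)%:E * neglog q)%E); last first.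
  apply: lee_wpmul2l; first by rewrite lee_fin invr_ge0.
  apply: neglog_le eq; apply: eps_list_ge0; exact: chan_pow_stochastic.
rewrite /neglog gt_eqF// -EFinM lee_fin le_eqVlt; apply/orP; left; apply/eqP.
rewrite /q lnM ?posrE ?exprn_gt0 ?mulr_gt0 ?expR_gt0 ?ltr0n//.
rewrite !lnXn ?mulr_gt0 ?expR_gt0 ?ltr0n// lnM ?posrE ?expR_gt0 ?ltr0n// expRK.
rewrite -[(_ + _) *+ L]mulr_natl -[_ *+ n]mulr_natl /b.
have : n%:R != 0 :> R by rewrite pnatr_eq0 -lt0n.
by move=> ?; field.
Unshelve. all: by end_near. Qed.

Lemma list_exponent0_ge (f : X -> Y -> R) (P : X -> R) (k : R) :
    dist P -> (forall x y, 0 <= f x y) -> (forall x y, f x y ^+ L.+1 = W x y) ->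
    0 < k -> \sum_y (\sum_x P x * f x y) ^+ L.+1 <= k ->
  ((- ln k)%:E <= list_exponent0 W L)%E.
Proof.
move=> HP f0 fW k0 Kk; rewrite list_exponent0E; apply/lee_addgt0Pr => e e0.
have L0R : 0 < L%:R :> R by rewrite ltr0n.
(* At rate [e / L] the loss [L * r] is exactly [e]. *)
have el : 0 < e / L%:R by rewrite divr_gt0.
rewrite -leeBlDr// -EFinB; apply: le_ereal_sup_tmp.
exists (list_exponent W L (e / L%:R)); first by exists (e / L%:R) => //=; rewrite in_itv/= el.
have := list_exponent_ge HP f0 fW k0 Kk (ltW el).
by rewrite mulrC divfK ?gt_eqF.
Qed.

End Exponent.
End Limits.

(** * The large-list limit *)

Section GeometricMean.
Variables (R : realType) (X Y : finType) (W : X -> Y -> R).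
Hypothesis HW : stochastic W.

Lemma stochastic_le1 x y : W x y <= 1.
Proof.
have [W0 W1] := HW; rewrite -(W1 x) (bigD1 y)//= lerDl; exact: sumr_ge0.
Qed.

(** The root of order [L + 1] of [W x y]; zero is treated apart because [ln] does not represent an
    infinite logarithm. *)
Definition root_channel (L : nat) (x : X) (y : Y) : R :=
  if W x y == 0 then 0 else expR (ln (W x y) / L.+1%:R).

Lemma root_channel_ge0 L x y : 0 <= root_channel L x y.
Proof. by rewrite /root_channel; case: ifP => // _; exact: expR_ge0. Qed.

Lemma root_channelX L x y : root_channel L x y ^+ L.+1 = W x y.
Proof.
have [W0 _] := HW.
rewrite /root_channel; case: eqVneq => [->|Wxy]; first by rewrite expr0n.
by rewrite -expRM_natr divfK ?pnatr_eq0// lnK// posrE lt_def Wxy W0.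
Qed.

Lemma ln_channel_le0 x y : ln (W x y) <= 0.
Proof. by apply: ln_le0; exact: stochastic_le1. Qed.

Lemma root_channel_le1 L x y : root_channel L x y <= 1.
Proof.
rewrite /root_channel; case: ifP => // _; rewrite -expR0 ler_expR.
by rewrite pmulr_lle0 ?invr_gt0// ln_channel_le0.
Qed.

(** The weighted product of [W x y] to the power [P x], with the convention [0 ^ 0 = 1]. *)
Definition geom_mean (P : X -> R) (y : Y) : R :=
  if [exists x, (P x != 0) && (W x y == 0)] then 0
  else expR (\sum_x P x * ln (W x y)).

Lemma geom_mean_ge0 P y : 0 <= geom_mean P y.
Proof. by rewrite /geom_mean; case: ifP => // _; exact: expR_ge0. Qed.

(** Multiplication by [1 - s] reduces it to [expR s * (1 - s) <= 1 <= 1 - s ^+ 3]. *)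
Lemma expR_le_quadratic (s : R) : s <= 0 -> expR s <= 1 + s + s ^+ 2.
Proof.
move=> s0; have h : expR s * (1 - s) <= 1.
  rewrite -[leRHS](expRxMexpNx_1 s) ler_wpM2l ?expR_ge0//; exact: expR_ge1Dx.
rewrite -(@ler_pM2r _ (1 - s)); last lra.
apply: (le_trans h); have : 0 <= (- s) ^+ 3 by rewrite exprn_ge0// oppr_ge0.
by nra.
Qed.

(* The left-hand side is the power mean of order [1 / (L + 1)] of [W _ y] under [P];
   only the upper bound in its convergence to the geometric mean is needed. *)
Lemma power_mean_bound (P : X -> R) (y : Y) : dist P ->
  exists2 s : nat -> R, s n @[n --> \oo] --> geom_mean P y &
    forall L, (\sum_x P x * root_channel L x y) ^+ L.+1 <= s L.
Proof.
move=> [P0 P1]; rewrite /geom_mean.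
have avg0 L : 0 <= \sum_x P x * root_channel L x y.
  by apply: sumr_ge0 => x _; rewrite mulr_ge0// root_channel_ge0.
case: ifPn => [/existsP[x0 /andP[Px0 /eqP Wx0]]|/existsPn ac].
  have Px0p : 0 < P x0 by rewrite lt_def Px0 P0.
  have PE : 1 - P x0 = \sum_(x | x != x0) P x by rewrite -P1 (bigD1 x0)//= addrAC subrr add0r.
  have P1ge0 : 0 <= 1 - P x0 by rewrite PE sumr_ge0.
  (* The letter [x0] contributes nothing, so the mean is at most [1 - P x0 < 1] and its powers
     vanish. *)
  exists (fun L => (1 - P x0) ^+ L.+1) => [|L].
    rewrite (cvg_shiftS (fun L => (1 - P x0) ^+ L)).
    by apply: cvg_expr; rewrite ger0_norm// gtrBl.
  rewrite lerXn2r ?nnegrE// PE (bigD1 x0)//= {1}/root_channel Wx0 eqxx mulr0 add0r.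
  by apply: ler_sum => x _; rewrite ler_piMr// root_channel_le1.
(* [C] collects the second-order terms: the mean is at most [1 + a / L.+1 + C / L.+1 ^+ 2], whose
   power of order [L.+1] is at most [expR (a + C / L.+1)]. *)
pose C := \sum_x P x * ln (W x y) ^+ 2.
exists (fun L => expR (\sum_x P x * ln (W x y) + C * L.+1%:R^-1)) => [|L].
  apply: continuous_cvg; first exact: continuous_expR.
  rewrite -[X in _ --> X]addr0 -[X in _ --> _ + X](mulr0 C).
  by apply: cvgD; [exact: cvg_cst|apply: cvgM; [exact: cvg_cst|exact: cvg_harmonic]].
have L0 : L.+1%:R != 0 :> R by rewrite pnatr_eq0.
pose a := \sum_x P x * ln (W x y).
have -> : a + C * L.+1%:R^-1 = (a / L.+1%:R + C / L.+1%:R ^+ 2) * L.+1%:R by field.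
rewrite expRM_natr lerXn2r ?nnegrE ?expR_ge0//.
apply: le_trans (expR_ge1Dx _).
have -> : 1 + (a / L.+1%:R + C / L.+1%:R ^+ 2) =
    \sum_x P x * (1 + ln (W x y) / L.+1%:R + (ln (W x y) / L.+1%:R) ^+ 2).
  rewrite -[X in X + _ = _]P1 /a /C !mulr_suml -!big_split/=; apply: eq_bigr => x _.
  by rewrite expr_div_n; ring.
apply: ler_sum => x _; have [->|Px] := eqVneq (P x) 0; first by rewrite !mul0r.
rewrite ler_wpM2l// /root_channel; have := ac x; rewrite Px/= => /negPf ->.
by apply: expR_le_quadratic; rewrite pmulr_lle0 ?invr_gt0// ln_channel_le0.
Qed.

Lemma power_mean_sum_lt (P : X -> R) (k : R) : dist P -> \sum_y geom_mean P y < k ->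
  exists2 L, (0 < L)%N & \sum_y (\sum_x P x * root_channel L x y) ^+ L.+1 <= k.
Proof.
move=> HP Gk.
have /choice[s Hs] : forall y, exists s : nat -> R, s n @[n --> \oo] --> geom_mean P y /\
    forall L, (\sum_x P x * root_channel L x y) ^+ L.+1 <= s L.
  by move=> y; have [s] := power_mean_bound y HP; exists s.
have sG : \sum_y s y n @[n --> \oo] --> \sum_y geom_mean P y.
  by apply: cvg_big => [|y _]; [exact: add_continuous|have [] := Hs y].
have [N _ sk] := cvgr_lt _ sG _ Gk.
(* The successor guarantees a positive list size. *)
exists N.+1 => //; apply: le_trans (ltW (sk N.+1 (leqnSn N))).
by apply: ler_sum => y _; have [_] := Hs y.
Qed.

(* The minimizing output distribution is the normalized geometric mean. *)
Lemma inf_KL_le (P : X -> R) : dist P -> 0 < \sum_y geom_mean P y ->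
  (ereal_inf [set KL (prod_dist P Q) (joint_dist P W) | Q in @dist R Y] <=
   (- ln (\sum_y geom_mean P y))%:E)%E.
Proof.
move=> [P0 P1]; set G := \sum_y _ => G0; have [W0 _] := HW.
pose Q y := geom_mean P y / G.
have HQ : dist Q.
  split=> [y|]; first by rewrite divr_ge0 ?geom_mean_ge0// ltW.
  by rewrite -mulr_suml divff// gt_eqF.
apply: ereal_inf_le => /=.
exists (KL (prod_dist P Q) (joint_dist P W)); first by exists Q.
have gN0 y : Q y != 0 -> [exists x, (P x != 0) && (W x y == 0)] = false.
  by rewrite /Q /geom_mean; case: ifP => //; rewrite mul0r eqxx.
have ac x y : P x != 0 -> Q y != 0 -> W x y != 0.
  by move=> Px /gN0/negbT/existsPn/(_ x); rewrite Px.
rewrite /KL; case: ifPn => [/existsP[[x y]]|_].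
  rewrite /prod_dist /joint_dist/= mulf_eq0 negb_or => /andP[/andP[Px Qy]].
  by rewrite mulf_eq0 (negPf Px) (negPf (ac _ _ Px Qy)).
rewrite lee_fin le_eqVlt; apply/orP; left; apply/eqP.
transitivity (\sum_y \sum_x P x * (Q y * (ln (Q y) - ln (W x y)))).
  rewrite exchange_big/= pair_big/=; apply: eq_bigr => -[x y] _.
  rewrite /prod_dist /joint_dist/=.
  have [->|Px] := eqVneq (P x) 0; first by rewrite !mul0r eqxx.
  have [->|Qy] := eqVneq (Q y) 0; first by rewrite !(mul0r, mulr0) eqxx.
  rewrite mulf_eq0 (negPf Px) (negPf Qy)/= -mulf_div divff// mul1r.
  rewrite ln_div ?mulrA// posrE lt_def; first by rewrite Qy HQ.1.
  by rewrite (ac _ _ Px Qy) W0.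
(* On the support of [Q], [ln (Q y)] minus the [P]-average of [ln (W x y)] is the constant
   [- ln G]. *)
transitivity (\sum_y Q y * - ln G); last by rewrite -mulr_suml HQ.2 mul1r.
apply: eq_bigr => y _; under eq_bigr do rewrite mulrCA.
rewrite -mulr_sumr; have [->|Qy] := eqVneq (Q y) 0; first by rewrite !mul0r.
congr (_ * _); under eq_bigr do rewrite mulrBr.
rewrite sumrB -mulr_suml P1 mul1r {1}/Q /geom_mean gN0// ln_div ?posrE ?expR_gt0//.
by rewrite expRK; ring.
Qed.

End GeometricMean.

(** * Converse and large-list limit combined *)

Theorem mainTheorem3 (R : realType) (X Y : finType) (W : X -> Y -> R)
  (HW : stochastic W) (HX : (0 < #|X|)%N) :
  (forall L : nat, (1 <= L)%N -> (list_exponent0 W L <= umlaut W)%E) /\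
  ereal_sup [set list_exponent0 W L | L in [set L : nat | (1 <= L)%N]]
    = umlaut W.
Proof.
have le_umlaut L : (1 <= L)%N -> (list_exponent0 W L <= umlaut W)%E.
  move=> L0; rewrite list_exponent0E//; apply: ge_ereal_sup => _ [r + <-].
  rewrite /= in_itv/= andbT; exact: list_exponent_le_umlaut.
split=> //; apply/eqP; rewrite eq_le; apply/andP; split.
  by apply: ge_ereal_sup => _ [L L0 <-]; exact: le_umlaut.
set S := ereal_sup _; apply: ge_ereal_sup => _ [P HP <-].
set G := \sum_y geom_mean W P y.
have S_ge (k : R) : 0 < k -> G < k -> ((- ln k)%:E <= S)%E.
  move=> k0 Gk; have [L L0 Kk] := power_mean_sum_lt HW HP Gk.
  apply: le_ereal_sup_tmp; exists (list_exponent0 W L); first by exists L.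
  apply: (list_exponent0_ge HW HX L0 HP _ _ k0 Kk) => x y; first exact: root_channel_ge0.
  exact: root_channelX.
have : 0 <= G by apply: sumr_ge0 => y _; exact: geom_mean_ge0.
rewrite [0 <= G]le_eqVlt => /orP[/eqP G0|G0].
  (* When [G = 0], every [k > 0] is admissible in [S_ge], so the supremum exceeds every real. *)
  suff -> : S = +oo%E by exact: leey.
  have SA (A : R) : (A%:E <= S)%E.
    by rewrite -[A]opprK -(expRK (- A)); apply: S_ge; rewrite -?G0 expR_gt0.
  case: (S) SA => [s /(_ (s + 1)%R)|//|/(_ 0%R)//].
  by rewrite lee_fin gerDl ler10.
apply: (le_trans (inf_KL_le HW HP G0)).
apply/lee_addgt0Pr => e e0; rewrite -leeBlDr// -EFinB.
have := S_ge (G * expR e); rewrite lnM ?posrE ?expR_gt0// expRK opprD; apply.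
  by rewrite mulr_gt0 ?expR_gt0.
by rewrite ltr_pMr// expR_gt1.
Qed.
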